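(* Let $X$ be a compact geodesic space and let $k\ge 1$ be the number of cops. For every $\varepsilon>0$ and $T>0$, there exist an integer $N$ and a finite agility $\tau^N:\{1,\dots,N\}\to\mathbb R_+$ with $T_N(\tau)=\sum_{n=1}^N\tau(n)\ge T$ such that for every initial position $(r,c)\in X^{k+1}$ we have $$\mathrm{Val}(r,c)-\varepsilon<\mathrm{Val}(r,c,N,\tau^N)<\mathrm{Val}(r,c)+\varepsilon.$$
   Context: $X$ is a compact geodesic space with metric $d$ (any two points $x,y$ are joined by a path of length $d(x,y)$). Positions are tuples $(r,c)=(r,c_1,\dots,c_k)\in X^{k+1}$. Put $d(r,c)=\min_i d(r,c_i)$ and $d(c,c')=\max_i d(c_i,c_i')$. An agility is a function $\tau:\mathbb N=\{1,2,\dots\}\to\mathbb R_+=[0,\infty)$; $\tau^N$ denotes its restriction to $\{1,\dots,N\}$, $T_N(\tau)=\sum_{n=1}^N\tau(n)$, and $\tau_1$ is the shift $\tau_1(i)=\tau(i+1)$. The value of the finite $N$-step game is defined recursively by $\mathrm{Val}(r,c,0,\tau^0)=d(r,c)$ and, for $N\ge1$, $$\mathrm{Val}(r,c,N,\tau^N)=\max_{r':\,d(r,r')\le\tau(1)}\ \min_{c':\,d(c,c')\le\tau(1)}\mathrm{Val}(r',c',N-1,\tau_1^{N-1})$$ (maximum and minimum are attained). For $T>0$ put $$\mathrm{Val}(r,c,T)=\sup_{N,\tau:\ T_N(\tau)=T}\mathrm{Val}(r,c,N,\tau^N),\qquad \mathrm{Val}(r,c)=\inf_{T>0}\mathrm{Val}(r,c,T).$$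 ($\mathrm{Val}(r,c,T)$ is non-increasing in $T$, so the infimum is the limit as $T\to\infty$.) *)

(* Defs.v *)
From HB Require Import structures.
From mathcomp Require Import all_boot all_order all_algebra.
From mathcomp Require Import all_classical all_reals all_analysis.
Set Implicit Arguments.
Unset Strict Implicit.
Unset Printing Implicit Defensive.
Import Order.TTheory GRing.Theory Num.Theory.
Import numFieldNormedType.Exports.
Local Open Scope classical_set_scope.
Local Open Scope ring_scope.

Section geodesic_space.
Context {R : realType} {X : metricType R}.

Definition inscribed_length (g : R -> X) (a b : R) (s : seq R) : R :=
  let p := g \o nth b (a :: s) in
  \sum_(0 <= n < size s) mdist (p n) (p n.+1).

Definition path_length (g : R -> X) (a b : R) : \bar R :=
  ereal_sup [set (inscribed_length g a b s)%:E | s in itv_partition a b].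

Definition geodesic_space : Prop :=
  forall x y : X, exists g : R -> X,
    [/\ {within `[0, 1], continuous g}, g 0 = x, g 1 = y &
        path_length g 0 1 = (mdist x y)%:E].

End geodesic_space.
Arguments geodesic_space {R} X.

Section agility.
Context {R : realType}.

(* Steps are numbered from 1: the value [tau 0] is never used. *)
Definition agility (tau : nat -> R) : Prop :=
  forall n, (1 <= n)%N -> 0 <= tau n.

Definition shift_agility (tau : nat -> R) : nat -> R := fun i => tau i.+1.

Definition duration (N : nat) (tau : nat -> R) : R :=
  \sum_(1 <= n < N.+1) tau n.

End agility.

Section game.
Context {R : realType} {X : metricType R} {k : nat}.

(* The infimum of a finite family, hence its minimum when [0 < k]. *)
Definition robber_cops_dist (r : X) (c : 'I_k -> X) : R :=
  inf [set mdist r (c i) | i in [set: 'I_k]].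

Definition cops_dist (c c' : 'I_k -> X) : R :=
  \big[Num.max/0]_(i < k) mdist (c i) (c' i).

(* The extrema are written as [sup] and [inf]; on a compact space they are
   attained.  Only the values of [tau] on {1, ..., N} are used. *)
Fixpoint game_value (N : nat) (tau : nat -> R) (r : X) (c : 'I_k -> X) : R :=
  if N is N'.+1 then
    sup [set inf [set game_value N' (shift_agility tau) r' c'
                   | c' in [set c' | cops_dist c c' <= tau 1%N]]
          | r' in [set r' | mdist r r' <= tau 1%N]]
  else robber_cops_dist r c.

Definition value_at (r : X) (c : 'I_k -> X) (T : R) : R :=
  sup [set v | exists (N : nat) (tau : nat -> R),
    [/\ agility tau, duration N tau = T & v = game_value N tau r c]].

Definition value (r : X) (c : 'I_k -> X) : R :=
  inf [set value_at r c T | T in [set T | 0 < T]].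

End game.

(* Main.v *)
(** A value of the game is 1-Lipschitz in the position, uniformly in the
    agility, because in a geodesic space a move can be copied from a nearby
    position without increasing the gap.  Splitting a step in two can only help
    the robber, and prolonging the game can only help the cops; so any finitely
    many agilities of the same duration have a common refinement that is at
    least as good for the robber from every position, and [value_at] is
    nonincreasing in the duration.  Hence near-optimal agilities on a finite net
    of positions can be merged into one, which by the Lipschitz property is
    near-optimal everywhere. *)
Require Import Defs.
From mathcomp Require Import all_boot all_order all_algebra.
From mathcomp Require Import all_classical all_reals all_analysis.
From mathcomp Require Import lra.
Set Implicit Arguments.
Unset Strict Implicit.
Unset Printing Implicit Defensive.
Import Order.TTheory GRing.Theory Num.Theory.
Import numFieldNormedType.Exports.
Local Open Scope classical_set_scope.
Local Open Scope ring_scope.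

(** * Finite nets, and intermediate points in a geodesic space *)

Section metric.
Context {R : realType} {X : metricType R}.

Lemma compact_finite_net (e : R) : compact [set: X] -> 0 < e ->
  exists s : seq X, forall x, exists2 y, y \in s & mdist x y < e.
Proof.
move=> /compact_near_coveringP Xcov e0.
(* A property holds near [F] when it holds for all lists containing some fixed finite list.
   Near-covering compactness then turns the trivial one-point nets around each [x] into one list
   that serves all points. *)
pose F : set_system (seq X) :=
  filter_from [set: seq X] (fun s => [set t | {subset s <= t}]).
have FF : Filter F.
  apply: filter_from_filter; first by exists [::].
  move=> s t _ _; exists (s ++ t) => // u stu.
  by split=> x xs; apply: stu; rewrite mem_cat xs ?orbT.
have [//|s _ net] :=
  Xcov (seq X) F (fun s x => exists2 y, y \in s & mdist x y < e) FF.
  move=> x _; exists (ball x e, [set s : seq X | x \in s]).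
    split; first exact: nbhsx_ballx.
    by exists [:: x] => // s; apply; rewrite mem_head.
  move=> [y s] [/= xy xs]; exists x => //.
  by move: xy; rewrite ballEmdist /= metric_sym.
by exists s => x; have /(_ x) := net s (fun _ => id); exact.
Qed.

Lemma mdist_continuous (x : X) : continuous (mdist x).
Proof.
move=> y; apply/cvgrPdist_lt => e e0; near=> z.
have : ball y e z by near: z; exact: nbhsx_ballx.
rewrite ballEmdist /= => yz; rewrite ltr_norml.
have := metric_triangle x y z; have := metric_triangle x z y.
by rewrite (metric_sym z y) => *; apply/andP; split; lra.
Unshelve. all: by end_near. Qed.

(** Along a geodesic the distance from [x] varies continuously, so it takes the value [a] at some
    [g u]. Since the path is no longer than [mdist x y], at most [b] remains from [g u] to [y]. *)
Lemma geodesic_split (x y : X) (a b : R) : geodesic_space X ->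
  0 <= a -> 0 <= b -> mdist x y <= a + b ->
  exists2 z, mdist x z <= a & mdist z y <= b.
Proof.
move=> Xgeo a0 b0 xyab.
have [xya|axy] := leP (mdist x y) a; first by exists y; rewrite ?mdistxx.
have [g [gcont g0 g1 glen]] := Xgeo x y.
have dcont : {within `[0, 1], continuous (mdist x \o g)}.
  by apply: within_continuous_comp gcont => z _; exact: mdist_continuous.
have [|u u01 ua] := @IVT R (mdist x \o g) 0 1 a ler01 dcont.
  by rewrite /= g0 g1 mdistxx min_l ?max_r ?mdist_ge0// a0 ltW.
exists (g u); first by rewrite -ua.
move: u01; rewrite in_itv/= => /andP[u0 u1].
(* Partitions are strictly increasing, so the endpoints are set aside before [[:: u; 1]] is used. *)
have [u0'|u_neq0] := eqVneq u 0.
  by move: ua; rewrite /= u0' g0 mdistxx => a_eq0; rewrite -a_eq0 add0r in xyab.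
have [u1'|u_neq1] := eqVneq u 1; first by rewrite u1' g1 mdistxx.
have : ((inscribed_length g 0 1 [:: u; 1])%:E <= path_length g 0 1)%E.
  apply: ereal_sup_ubound; exists [:: u; 1] => //; split=> //=.
  by rewrite !lt_neqAle u0 u1 u_neq1 eq_sym u_neq0.
rewrite glen lee_fin /inscribed_length /= 2?big_nat_recl// big_geq//= g0 g1.
by move: ua => /=; lra.
Qed.

End metric.

(** * Distances between positions *)

Section game.
Context {R : realType} {X : metricType R} {k : nat}.
Implicit Types (r : X) (c : 'I_k -> X) (V W : X -> ('I_k -> X) -> R) (t : R).

Lemma cops_dist_le c c' t :
  0 <= t -> (forall i, mdist (c i) (c' i) <= t) -> cops_dist c c' <= t.
Proof. by move=> t0 cc'; apply: bigmax_le. Qed.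

Lemma mdist_le_cops_dist c c' i : mdist (c i) (c' i) <= cops_dist c c'.
Proof. exact: (@le_bigmax _ _ _ 0 (fun i => mdist (c i) (c' i)) i). Qed.

Lemma cops_dist_ge0 c c' : 0 <= cops_dist c c'.
Proof. exact: bigmax_ge_id. Qed.

Lemma cops_distxx c : cops_dist c c = 0.
Proof.
apply/eqP; rewrite eq_le cops_dist_ge0 andbT.
by apply: cops_dist_le => // i; rewrite mdistxx.
Qed.

Lemma cops_dist_sym c c' : cops_dist c c' = cops_dist c' c.
Proof. by apply: eq_bigr => i _; rewrite metric_sym. Qed.

Lemma cops_dist_triangle c c' c'' :
  cops_dist c c'' <= cops_dist c c' + cops_dist c' c''.
Proof.
apply: cops_dist_le => [|i]; first by rewrite addr_ge0// cops_dist_ge0.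
by rewrite (le_trans (metric_triangle _ (c' i) _))// lerD ?mdist_le_cops_dist.
Qed.

Lemma robber_cops_dist_le r c i : robber_cops_dist r c <= mdist r (c i).
Proof.
by apply: ge_inf; [exists 0 => _ [j _ <-]; exact: mdist_ge0|exists i].
Qed.

Lemma robber_cops_dist_attained r c :
  (0 < k)%N -> exists i, robber_cops_dist r c = mdist r (c i).
Proof.
move=> k0; pose i0 := Ordinal k0.
exists [arg min_(i < i0) mdist r (c i)]%O.
case: arg_minP => // i _ imin; apply/eqP; rewrite eq_le robber_cops_dist_le /=.
apply: lb_le_inf => [|_ [j _ <-]]; last exact: imin.
by exists (mdist r (c i)), i.
Qed.

Lemma robber_cops_dist_lip r c r' c' : (0 < k)%N ->
  robber_cops_dist r c <= robber_cops_dist r' c' + (mdist r r' + cops_dist c c').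
Proof.
move=> /(robber_cops_dist_attained r' c')[i ->].
have := robber_cops_dist_le r c i; have := mdist_le_cops_dist c c' i.
have := metric_triangle r r' (c i); have := metric_triangle r' (c' i) (c i).
by rewrite (metric_sym (c' i) (c i)); lra.
Qed.

(** * One step of the game as an operator on value functions *)

Definition reply_value t V r c : R :=
  inf [set V r c' | c' in [set c' | cops_dist c c' <= t]].

Definition step_value t V r c : R :=
  sup [set reply_value t V r' c | r' in [set r' | mdist r r' <= t]].

Definition steps_value : seq R -> X -> ('I_k -> X) -> R :=
  foldr step_value robber_cops_dist.

(* These bounds keep every [sup] and [inf] of the game away from the junk
   value of an unbounded set. *)
Definition admissible V := forall r c, 0 <= V r c <= robber_cops_dist r c.

Definition lipschitz_value V := forall r c r' c',
  V r c <= V r' c' + (mdist r r' + cops_dist c c').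

Lemma admissible_ge0 V r c : admissible V -> 0 <= V r c.
Proof. by move=> /(_ r c)/andP[]. Qed.

Lemma admissible_le V r c : admissible V -> V r c <= robber_cops_dist r c.
Proof. by move=> /(_ r c)/andP[]. Qed.

Lemma reply_value_le t V r c c' : admissible V -> cops_dist c c' <= t ->
  reply_value t V r c <= V r c'.
Proof.
move=> VA cc'; apply: ge_inf; last by exists c'.
by exists 0 => _ [c'' _ <-]; exact: admissible_ge0.
Qed.

Lemma le_reply_value t V r c x : 0 <= t ->
  (forall c', cops_dist c c' <= t -> x <= V r c') -> x <= reply_value t V r c.
Proof.
move=> t0 xV; apply: lb_le_inf => [|_ [c' cc' <-]]; last exact: xV.
by exists (V r c), c => //=; rewrite cops_distxx.
Qed.

Lemma step_value_le t V r c x : 0 <= t ->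
  (forall r', mdist r r' <= t -> reply_value t V r' c <= x) ->
  step_value t V r c <= x.
Proof.
move=> t0 Vx; apply: ge_sup => [|_ [r' rr' <-]]; last exact: Vx.
by exists (reply_value t V r c), r => //=; rewrite mdistxx.
Qed.

Section k_gt0.
Context (k_gt0 : (0 < k)%N).

Lemma reply_le_step_value t V r r' c : 0 <= t -> admissible V ->
  mdist r r' <= t -> reply_value t V r' c <= step_value t V r c.
Proof.
move=> t0 VA rr'; apply: ub_le_sup; last by exists r'.
(* The cops may stay put, and a robber's move of length at most [t] raises the gap by at most
   [t]. *)
exists (robber_cops_dist r c + t) => _ [r'' /= rr'' <-].
have := @reply_value_le t V r'' c c VA; rewrite cops_distxx => /(_ t0).
have := admissible_le r'' c VA; have := robber_cops_dist_lip r'' c r c k_gt0.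
by rewrite cops_distxx (metric_sym r'' r); lra.
Qed.

Lemma le_step_value t V W r c : 0 <= t -> admissible V -> admissible W ->
  (forall r c, V r c <= W r c) -> step_value t V r c <= step_value t W r c.
Proof.
move=> t0 VA WA VW; apply: step_value_le => // r' rr'.
apply: le_trans (reply_le_step_value c t0 WA rr').
apply: le_reply_value => // c' cc'.
exact: le_trans (reply_value_le _ VA cc') (VW _ _).
Qed.

Lemma step_value0 V : admissible V -> step_value 0 V = V.
Proof.
move=> VA; apply/funext => r; apply/funext => c; apply/eqP; rewrite eq_le.
apply/andP; split.
  apply: step_value_le => // r' rr'.
  have <- : r = r'.
    by apply: mdist_positivity; apply/eqP; rewrite eq_le rr' mdist_ge0.
  by apply: reply_value_le => //; rewrite cops_distxx.
apply: (@le_trans _ _ (reply_value 0 V r c)).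
  apply: le_reply_value => // c' cc'.
  have <- // : c = c'.
  apply/funext => i; apply: mdist_positivity; apply/eqP.
  by rewrite eq_le mdist_ge0 (le_trans (mdist_le_cops_dist _ _ _) cc').
by apply: reply_le_step_value; rewrite ?mdistxx.
Qed.

Context (Xgeo : geodesic_space X).

Lemma cops_dist_split c c' (a b : R) :
  0 <= a -> 0 <= b -> cops_dist c c' <= a + b ->
  exists2 c'', cops_dist c c'' <= a & cops_dist c'' c' <= b.
Proof.
move=> a0 b0 cc'.
have /choice[f fP] i : exists z, mdist (c i) z <= a /\ mdist z (c' i) <= b.
  have [|z za zb] := @geodesic_split R X (c i) (c' i) a b Xgeo a0 b0.
    exact: le_trans (mdist_le_cops_dist _ _ _) cc'.
  by exists z.
by exists f; apply: cops_dist_le => // i; have [] := fP i.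
Qed.

(* The cop nearest to the robber follows him, so the gap need not grow. *)
Lemma step_value_admissible t V : 0 <= t -> admissible V ->
  admissible (step_value t V).
Proof.
move=> t0 VA r c; apply/andP; split.
  apply: (@le_trans _ _ (reply_value t V r c)).
    by apply: le_reply_value => // c' _; exact: admissible_ge0.
  by apply: reply_le_step_value; rewrite ?mdistxx.
apply: step_value_le => // r' rr'.
have [i rcE] := robber_cops_dist_attained r c k_gt0.
have [|z cz zr'] := @geodesic_split R X (c i) r' t (mdist r (c i)) Xgeo t0
    (mdist_ge0 _ _).
  by have := metric_triangle (c i) r r'; rewrite (metric_sym (c i) r); lra.
pose c' j := if j == i then z else c j.
have cc' : cops_dist c c' <= t.
  apply: cops_dist_le => // j; rewrite /c'; case: eqP => [->//|_].
  by rewrite mdistxx.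
apply: (le_trans (reply_value_le r' VA cc')).
apply: (le_trans (admissible_le r' c' VA)).
apply: (le_trans (robber_cops_dist_le r' c' i)).
by rewrite rcE /c' eqxx metric_sym.
Qed.

(** Moves are shadowed: the robber at [s] ends within [mdist r s] of the target [r'], and the cops
    at [c] end within [cops_dist c d] of the reply [d']. *)
Lemma step_value_lipschitz t V : 0 <= t -> admissible V ->
  lipschitz_value V -> lipschitz_value (step_value t V).
Proof.
move=> t0 VA VL r c s d; apply: step_value_le => // r' rr'.
have [|s' ss' s'r'] :=
    @geodesic_split R X s r' t (mdist r s) Xgeo t0 (mdist_ge0 _ _).
  by have := metric_triangle s r r'; rewrite (metric_sym s r); lra.
rewrite -lerBlDr.
apply: le_trans (reply_le_step_value d t0 VA ss').
apply: le_reply_value => // d' dd'.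
have [|c' cc' c'd'] := @cops_dist_split c d' t (cops_dist c d) t0
    (cops_dist_ge0 _ _).
  by have := cops_dist_triangle c d d'; lra.
have := reply_value_le r' VA cc'; have := VL r' c' s' d'.
by rewrite (metric_sym r' s'); lra.
Qed.

(* Against a split move the robber follows a geodesic to his target, while the
   cops' two replies still add up to a legal reply to the undivided move. *)
Lemma step_value_split (a b : R) V r c : 0 <= a -> 0 <= b -> admissible V ->
  step_value (a + b) V r c <= step_value a (step_value b V) r c.
Proof.
move=> a0 b0 VA; apply: step_value_le => [|r' rr']; first exact: addr_ge0.
have [r1 rr1 r1r'] := geodesic_split Xgeo a0 b0 rr'.
have VbA := step_value_admissible b0 VA.
apply: le_trans (reply_le_step_value c a0 VbA rr1).
apply: le_reply_value => // c1 cc1.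
apply: le_trans (reply_le_step_value c1 b0 VA r1r').
apply: le_reply_value => // c' c1c'.
apply: reply_value_le => //.
by rewrite (le_trans (cops_dist_triangle _ c1 _))// lerD.
Qed.

(** * Agilities as lists of step lengths; refinement and truncation *)

Local Notation nonneg := (all (fun t : R => 0 <= t)).
Local Notation total s := (\sum_(t <- s) t).

Lemma steps_value_admissible (s : seq R) :
  nonneg s -> admissible (steps_value s).
Proof.
elim: s => [_ r c|t s IH /= /andP[t0 /IH]]; last exact: step_value_admissible.
rewrite /= lexx andbT.
by have [i ->] := robber_cops_dist_attained r c k_gt0; exact: mdist_ge0.
Qed.

Lemma steps_value_lipschitz (s : seq R) :
  nonneg s -> lipschitz_value (steps_value s).
Proof.
elim: s => [_ r c r' c'|t s IH /= /andP[t0 s0]].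
  exact: robber_cops_dist_lip.
by apply: step_value_lipschitz => //; [exact: steps_value_admissible|exact: IH].
Qed.

Lemma total_ge0 (s : seq R) : nonneg s -> 0 <= total s.
Proof. by move=> /allP s0; rewrite big_seq sumr_ge0. Qed.

Lemma steps_value_total0 (s : seq R) : nonneg s -> total s = 0 ->
  steps_value s = robber_cops_dist.
Proof.
elim: s => // t s IH /= /andP[t0 s0]; rewrite big_cons => ts0.
have tE : t = 0 by have := total_ge0 s0; lra.
rewrite tE step_value0; last exact: steps_value_admissible.
by apply: IH => //; rewrite tE add0r in ts0.
Qed.

(** The two sets of time marks are merged: the shorter head, say [a], becomes the first step of [u],
    the other head [b] is split into [a] and [b - a], and induction on the total size handles [s]
    and [b - a :: t]. *)
Lemma common_refinement2 (s t : seq R) : nonneg s -> nonneg t ->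
  total s = total t ->
  exists u : seq R, [/\ nonneg u, total u = total s,
    forall r c, steps_value s r c <= steps_value u r c &
    forall r c, steps_value t r c <= steps_value u r c].
Proof.
have [n] := ubnP (size s + size t); elim: n s t => // n IH [|a s] [|b t] /=.
- by move=> _ _ _ _; exists [::].
(* Against an empty list the other one has only zero steps, which change nothing. *)
- move=> _ _ bt0; rewrite big_nil => /esym bt_total; exists (b :: t).
  by split=> // r c; rewrite [in leRHS](@steps_value_total0 (b :: t)).
- move=> _ as0 _; rewrite big_nil => as_total; exists (a :: s).
  by split=> // r c; rewrite [in leRHS](@steps_value_total0 (a :: s)).
wlog ab : a s b t / a <= b => [wlog|] size_lt.
  have [ab|/ltW ba] := leP a b; first exact: wlog.
  move=> as0 bt0 /esym E.
  have [|u [u0 uE su tu]] := wlog b t a s ba _ bt0 as0 E.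
    by rewrite addnC.
  by exists u; split=> //; rewrite uE.
move=> /andP[a0 s0] /andP[b0 t0]; rewrite !big_cons => E.
have ba0 : 0 <= b - a by rewrite subr_ge0.
have [||||u [u0 uE su tu]] := IH s (b - a :: t).
- by move: size_lt; rewrite /= addSn ltnS.
- by [].
- by rewrite /= ba0.
- by rewrite big_cons; lra.
have uA := steps_value_admissible u0.
exists (a :: u); split=> [||r c|r c] /=.
- by rewrite a0.
- by rewrite big_cons uE.
- by apply: le_step_value => //; exact: steps_value_admissible.
have tA := steps_value_admissible t0.
apply: (@le_trans _ _ (step_value a (step_value (b - a) (steps_value t)) r c)).
  by rewrite -[X in step_value X _ _ _ <= _](subrKC a); exact: step_value_split.
by apply: le_step_value => //; exact: step_value_admissible.
Qed.

Lemma common_refinement (I : eqType) (l : seq I) (f : I -> seq R) (T : R) :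
  0 <= T -> (forall i, nonneg (f i)) -> (forall i, total (f i) = T) ->
  exists u : seq R, [/\ nonneg u, total u = T &
    forall i, i \in l -> forall r c, steps_value (f i) r c <= steps_value u r c].
Proof.
move=> T0 f0 fT; elim: l => [|i l [u [u0 uT lu]]].
  by exists [:: T]; rewrite /= T0 big_seq1.
have [|v [v0 vT iv uv]] := common_refinement2 (f0 i) u0; first by rewrite fT uT.
exists v; split=> // [|j]; first by rewrite vT.
rewrite inE => /predU1P[->//|/lu ju] r c; exact: le_trans (ju _ _) (uv _ _).
Qed.

(** The step running across time [T] is split there. Whatever is played after [T] has value at most
    the distance reached at [T], by admissibility, so stopping favours the robber. *)
Lemma steps_value_truncate (s : seq R) (T : R) :
  nonneg s -> 0 <= T <= total s ->
  exists u : seq R, [/\ nonneg u, total u = T &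
    forall r c, steps_value s r c <= steps_value u r c].
Proof.
elim: s T => [T _|a s IH T /= /andP[a0 s0]].
  by rewrite big_nil -eq_le => /eqP <-; exists [::]; rewrite big_nil.
rewrite big_cons => /andP[T0 Tas].
have sA := steps_value_admissible s0.
have [aT|/ltW Ta] := leP a T.
  have [|u [u0 uT su]] := IH (T - a) s0; first by apply/andP; split; lra.
  exists (a :: u); split=> [||r c] /=; first by rewrite a0.
    by rewrite big_cons uT; lra.
  by apply: le_step_value => //; exact: steps_value_admissible.
exists [:: T]; split=> [||r c] /=; [by rewrite T0|by rewrite big_seq1|].
have aT0 : 0 <= a - T by rewrite subr_ge0.
rewrite -[X in step_value X _ _ _ <= _](subrKC T).
apply: (le_trans (step_value_split r c T0 aT0 sA)).
have saTA := step_value_admissible aT0 sA.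
apply: le_step_value => //; first exact: (@steps_value_admissible [::]).
by move=> r' c'; exact: admissible_le.
Qed.

(** * Translation between agilities and lists *)

Lemma game_value_steps (N : nat) (tau : nat -> R) r c :
  game_value N tau r c = steps_value (mkseq (fun i => tau i.+1) N) r c.
Proof.
have -> : mkseq (fun i => tau i.+1) N = map tau (iota 1 N).
  by rewrite (iotaDl 1 0) -map_comp.
elim: N tau r c => // N IH tau r c /=.
congr sup; apply: eq_imagel => r' _; congr inf; apply: eq_imagel => c' _.
by rewrite IH (iotaDl 1 1) -map_comp.
Qed.

Lemma duration_total (N : nat) (tau : nat -> R) :
  duration N tau = total (mkseq (fun i => tau i.+1) N).
Proof. by rewrite /duration /mkseq big_map big_add1 /= /index_iota subn0. Qed.

(** The predecessor accounts for numbering from 1; past the end of the list the default 0 keeps the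
    agility nonnegative. *)
Definition agility_of (s : seq R) : nat -> R := fun n => nth 0 s n.-1.

Lemma agility_ofP (s : seq R) : nonneg s ->
  [/\ agility (agility_of s), duration (size s) (agility_of s) = total s &
    forall r c, game_value (size s) (agility_of s) r c = steps_value s r c].
Proof.
move=> s0; have sE := mkseq_nth 0 s.
split=> [n _||r c]; rewrite ?duration_total ?game_value_steps ?sE//.
have [ns|ns] := ltnP n.-1 (size s); last by rewrite /agility_of nth_default.
by have /allP -> // := s0; exact: mem_nth.
Qed.

(** * The values [value_at] and [value] in terms of lists *)

Lemma value_atE r c (T : R) :
  value_at r c T =
  sup [set steps_value s r c | s in [set s | nonneg s /\ total s = T]].
Proof.
congr sup; apply/seteqP; split=> [_ [N [tau [tau0 tauT ->]]]|_ [s [s0 sT] <-]].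
  exists (mkseq (fun i => tau i.+1) N); last by rewrite game_value_steps.
  split; rewrite -?duration_total//.
  by apply/allP => _ /mapP[i _ ->]; exact: tau0.
have [? sE sV] := agility_ofP s0.
by exists (size s), (agility_of s); rewrite sE sV.
Qed.

Let steps_value_set r c (T : R) : 0 <= T ->
  has_sup [set steps_value s r c | s in [set s | nonneg s /\ total s = T]].
Proof.
move=> T0; split.
  by exists (steps_value [:: T] r c), [:: T] => //=; rewrite T0 big_seq1.
exists (robber_cops_dist r c) => _ [s [s0 _] <-].
exact/admissible_le/steps_value_admissible.
Qed.

Lemma steps_value_le_value_at r c (s : seq R) :
  nonneg s -> steps_value s r c <= value_at r c (total s).
Proof.
move=> s0; rewrite value_atE; apply: ub_le_sup; last by exists s.
by have [] := steps_value_set r c (total_ge0 s0).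
Qed.

Lemma value_at_le r c (T x : R) : 0 <= T ->
  (forall s : seq R, nonneg s -> total s = T -> steps_value s r c <= x) ->
  value_at r c T <= x.
Proof.
move=> T0 Tx; rewrite value_atE; apply: ge_sup => [|_ [s [s0 sT] <-]].
  by have [] := steps_value_set r c T0.
exact: Tx.
Qed.

Lemma value_at_approx r c (T e : R) : 0 <= T -> 0 < e ->
  exists s : seq R,
    [/\ nonneg s, total s = T & value_at r c T - e < steps_value s r c].
Proof.
move=> T0 e0; rewrite value_atE.
have [_ [s [s0 sT] <-] ?] := sup_adherent e0 (steps_value_set r c T0).
by exists s.
Qed.

Lemma value_at_ge0 r c (T : R) : 0 <= T -> 0 <= value_at r c T.
Proof.
move=> T0; have T0' : nonneg [:: T] by rewrite /= T0.
have := steps_value_le_value_at r c T0'; rewrite big_seq1; apply: le_trans.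
exact/admissible_ge0/steps_value_admissible.
Qed.

Lemma value_at_nonincreasing r c (T T' : R) : 0 <= T -> T <= T' ->
  value_at r c T' <= value_at r c T.
Proof.
move=> T0 TT'; apply: value_at_le => [|s s0 sT']; first exact: le_trans TT'.
have [|u [u0 <- su]] := @steps_value_truncate s T s0; first by rewrite T0 sT'.
exact: le_trans (su r c) (steps_value_le_value_at r c u0).
Qed.

Lemma value_at_lipschitz (T : R) : 0 <= T ->
  lipschitz_value (fun r c => value_at r c T).
Proof.
move=> T0 r c r' c'; apply: value_at_le => // s s0 sT.
have := steps_value_lipschitz s0 r c r' c'.
by have := steps_value_le_value_at r' c' s0; rewrite sT; lra.
Qed.

Lemma value_has_inf r c : has_inf [set value_at r c T | T in [set T | 0 < T]].
Proof.
split; first by exists (value_at r c 1), 1 => /=.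
by exists 0 => _ [T T0 <-]; rewrite value_at_ge0// ltW.
Qed.

Lemma value_le_value_at r c (T : R) : 0 < T -> value r c <= value_at r c T.
Proof.
by move=> T0; apply: ge_inf; [case: (value_has_inf r c)|exists T].
Qed.

Lemma value_approx r c (e : R) : 0 < e ->
  exists2 T : R, 0 < T & value_at r c T < value r c + e.
Proof.
move=> e0; have [_ [T T0 <-] ?] := inf_adherent e0 (value_has_inf r c).
by exists T.
Qed.

Lemma value_lipschitz : lipschitz_value (@value R X k).
Proof.
move=> r c r' c'; rewrite -lerBlDr.
apply: lb_le_inf => [|_ [T T0 <-]]; first by case: (value_has_inf r' c').
have := value_le_value_at r c T0.
by have := value_at_lipschitz (ltW T0) r c r' c'; rewrite lerBlDr; lra.
Qed.

End k_gt0.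

(** * A finite net of positions and the conclusion *)

Lemma compact_positions_net (e : R) : compact [set: X] -> 0 < e ->
  exists (J : finType) (p : J -> X) (q : J -> 'I_k -> X),
  forall r c, exists j, mdist r (p j) <= e /\ cops_dist c (q j) <= e.
Proof.
move=> Xco e0; have [s sP] := compact_finite_net Xco e0.
have /choice[f fP] x : exists i : 'I_(size s), mdist x (tnth (in_tuple s) i) <= e.
  by have [_ /(tnthP (in_tuple s))[i ->] /ltW] := sP x; exists i.
(* An index picks a net point for the robber and one for each cop. *)
pose J : finType := ('I_(size s) * {ffun 'I_k -> 'I_(size s)})%type.
exists J, (fun j : J => tnth (in_tuple s) j.1).
exists (fun (j : J) i => tnth (in_tuple s) (j.2 i)) => r c.
exists (f r, [ffun i => f (c i)]); split; first exact: fP.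
by apply: cops_dist_le => [|i]; [exact: ltW|rewrite ffunE].
Qed.

End game.

Theorem corollary7 (R : realType) (X : metricType R) (k : nat)
    (X_compact : compact [set: X]) (X_geodesic : geodesic_space X)
    (k_ge1 : (1 <= k)%N) (eps T : R) (eps_gt0 : 0 < eps) (T_gt0 : 0 < T) :
  exists (N : nat) (tau : nat -> R),
    [/\ agility tau, T <= duration N tau &
      forall (r : X) (c : 'I_k -> X),
        value r c - eps < game_value N tau r c < value r c + eps].
Proof.
(* Passing to a net position costs [2 * eps / 16] in [steps_value] and again in [value]; the choice
   of [S j] or of [f j] costs one more [eps / 16]. Each bound thus loses at most [5 * eps / 16]. *)
have e16 : 0 < eps / 16 by lra.
have [J [p [q net]]] := @compact_positions_net R X k _ X_compact e16.
have /choice[S SP] j : exists S : R,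
    0 < S /\ value_at (p j) (q j) S < value (p j) (q j) + eps / 16.
  by have [S] := value_approx k_ge1 X_geodesic (p j) (q j) e16; exists S.
(* A single duration exceeding [T] and every [S j]; by monotonicity [value_at] at [T1] is near
   [value] at all net positions. *)
pose T1 := T + \sum_j S j.
have sumS0 : 0 <= \sum_j S j by apply: sumr_ge0 => j _; case: (SP j) => /ltW.
have T1_gt0 : 0 < T1 by rewrite /T1; lra.
have ST1 j : S j <= T1.
  rewrite /T1 (bigD1 j)//=.
  have : 0 <= \sum_(i | i != j) S i.
    by apply: sumr_ge0 => i _; case: (SP i) => /ltW.
  by lra.
(* Each [f j] is near-optimal at its own net position only; the refinement [u] is so at all of
   them. *)
have /choice[f fP] j :=
  value_at_approx k_ge1 X_geodesic (p j) (q j) (ltW T1_gt0) e16.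
have [||u [u0 uT fu]] := common_refinement k_ge1 X_geodesic (enum J) (ltW T1_gt0)
    (f := f); [by move=> j; case: (fP j)|by move=> j; case: (fP j)|].
have [uag udur uval] := @agility_ofP R X k u u0.
exists (size u), (agility_of u); split=> // [|r c].
  by rewrite udur uT /T1; lra.
rewrite uval; have [j [rj cj]] := net r c.
have [Sj0 Sj] := SP j; have [fj0 fjT fj] := fP j.
have uL := steps_value_lipschitz k_ge1 X_geodesic u0.
have vL := value_lipschitz k_ge1 X_geodesic.
have := uL r c (p j) (q j); have := uL (p j) (q j) r c.
have := vL r c (p j) (q j); have := vL (p j) (q j) r c.
rewrite (metric_sym (p j)) (cops_dist_sym (q j)).
(* At the net position, [f j] bounds [u] from below, while [value_at] at [T1], hence at [S j],
   bounds it from above. *)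
have := fu j (mem_enum _ _) (p j) (q j).
have := steps_value_le_value_at k_ge1 X_geodesic (p j) (q j) u0; rewrite uT.
have := value_at_nonincreasing k_ge1 X_geodesic (p j) (q j) (ltW Sj0) (ST1 j).
have := value_le_value_at k_ge1 X_geodesic (p j) (q j) T1_gt0.
by move=> *; apply/andP; split; lra.
Qed.
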